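(* Let $(V,\mathcal{S})$ be a set system with $V=\{1,\dots,n\}$ in which every element lies in at most $t$ sets, and run the algorithm described in the context. Fix a set $S\in\mathcal{S}$ and let $D_S(T)=\sum_{i\in S}x_T(i)$. Then for every $\lambda\ge 0$, \[ \Pr\left[|D_S(T)|\ge\lambda\sqrt{t}\right]\le 8\exp\!\left(-\lambda^2/(100a)\right). \]
   Context: Algorithm. Parameters: $\gamma=1/(n^2\log n)$, $T=(12/\gamma^2)\log n$, $a=6$. Initialize $x_0=0\in\mathbb{R}^n$ and $A_1=V$. For $k=1,2,\dots,T$: let $\mathcal{B}_k=\{S\in\mathcal{S}:|S\cap A_k|\ge at\}$ (''big'' sets) and $\mathcal{L}_k=\mathcal{S}\setminus\mathcal{B}_k$ (''small'' sets). Compute an optimal solution $(u_i^k)_{i\in A_k}$, $u_i^k\in\mathbb{R}^n$, of the semidefinite program: maximize $\sum_{i\in A_k}\|u_i\|_2^2$ subject to $\|\sum_{i\in S\cap A_k}u_i\|_2^2=0$ for each $S\in\mathcal{B}_k$; $\|\sum_{i\in S\cap A_k}u_i\|_2^2\le 2\sum_{i\in S\cap A_k}\|u_i\|_2^2$ for each $S\in\mathcal{L}_k$; $\|\sum_{i\in S\cap A_k}x_{k-1}(i)u_i\|_2^2\le 2\sum_{i\in S\cap A_k}\|u_i\|_2^2$ for each $S\in\mathcal{L}_k$; $\|u_i\|_2^2\le 1$ for each $i\in A_k$. Draw $r_k\in\{-1,1\}^n$ with independent uniformly random coordinates (independently of the past). Set $x_k(i)=x_{k-1}(i)+\gamma\langle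 r_k,u_i^k\rangle$ for $i\in A_k$ and $x_k(i)=x_{k-1}(i)$ for $i\notin A_k$. Set $A_{k+1}=A_k\setminus\{i:|x_k(i)|\ge 1-1/n\}$. The vector $x_T$ is the fractional coloring after step $T$ (before any final rounding). *)

(* Defs.v *)
From HB Require Import structures.
From mathcomp Require Import all_boot all_order all_algebra.
From mathcomp Require Import reals sequences exp.

Set Implicit Arguments.
Unset Strict Implicit.
Unset Printing Implicit Defensive.
Import Order.TTheory GRing.Theory Num.Theory.

Local Open Scope ring_scope.

Section Euclidean.
Variables (R : realType) (n : nat).

Definition dot (u v : 'rV[R]_n) : R := \sum_j u 0 j * v 0 j.

(* The norm `|u| that the libraries put on 'rV[R]_n is the sup norm, hence
   this separate definition of the squared Euclidean norm. *)
Definition sqnorm2 (u : 'rV[R]_n) : R := dot u u.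

End Euclidean.

Definition max_degree (n : nat) (Sys : {set {set 'I_n}}) (t : nat) : Prop :=
  forall i : 'I_n, (#|[set S in Sys | i \in S]| <= t)%N.

Definition param_a : nat := 6.

Definition gamma (R : realType) (n : nat) : R := 1 / (n%:R ^+ 2 * ln n%:R).

(* (12 / gamma^2) log n, rounded up to an integer. *)
Definition num_steps (R : realType) (n : nat) : nat :=
  `|Num.ceil (12 / gamma R n ^+ 2 * ln n%:R)|%N.

Section SDP.
Variables (R : realType) (n : nat) (Sys : {set {set 'I_n}}) (t : nat).

Definition big_sets (A : {set 'I_n}) : {set {set 'I_n}} :=
  [set S in Sys | (param_a * t <= #|S :&: A|)%N].

Definition small_sets (A : {set 'I_n}) : {set {set 'I_n}} :=
  Sys :\: big_sets A.

(* A family (u_i)_{i in A} is encoded as a total function on 'I_n; neither the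
   constraints nor the objective look at u i for i \notin A. *)
Record sdp_feasible (A : {set 'I_n}) (x : 'I_n -> R) (u : 'I_n -> 'rV[R]_n) :
    Prop := SdpFeasible {
  sdp_big : forall S, S \in big_sets A ->
    sqnorm2 (\sum_(i in S :&: A) u i) = 0;
  sdp_small : forall S, S \in small_sets A ->
    sqnorm2 (\sum_(i in S :&: A) u i)
      <= 2 * \sum_(i in S :&: A) sqnorm2 (u i);
  sdp_small_weighted : forall S, S \in small_sets A ->
    sqnorm2 (\sum_(i in S :&: A) x i *: u i)
      <= 2 * \sum_(i in S :&: A) sqnorm2 (u i);
  sdp_unit : forall i, i \in A -> sqnorm2 (u i) <= 1
}.

Definition sdp_value (A : {set 'I_n}) (u : 'I_n -> 'rV[R]_n) : R :=
  \sum_(i in A) sqnorm2 (u i).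

Definition sdp_optimal (A : {set 'I_n}) (x : 'I_n -> R)
    (u : 'I_n -> 'rV[R]_n) : Prop :=
  sdp_feasible A x u /\
  forall v, sdp_feasible A x v -> sdp_value A v <= sdp_value A u.

End SDP.

(* A vector of {-1, 1}^n, with true coding -1. *)
Definition signs (n : nat) := {ffun 'I_n -> bool}.

Definition sign_vec (R : realType) (n : nat) (r : signs n) : 'rV[R]_n :=
  \row_j (-1) ^+ r j.

Section Algorithm.
Variables (R : realType) (n : nat).

(* A history is the list [:: r_k; ...; r_1] of the sign vectors drawn so far,
   most recent first.  A solver gives the vectors (u_i^(k+1))_i used at the next
   step; its choice among the optimal solutions may depend on the whole history
   but, by its type, not on the future draws. *)
Definition solver := seq (signs n) -> 'I_n -> 'rV[R]_n.

Definition next_coloring (A : {set 'I_n}) (x : 'I_n -> R)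
    (u : 'I_n -> 'rV[R]_n) (r : signs n) : 'I_n -> R :=
  fun i => if i \in A then x i + gamma R n * dot (sign_vec R r) (u i) else x i.

Definition next_alive (A : {set 'I_n}) (x : 'I_n -> R) : {set 'I_n} :=
  A :\: [set i | 1 - 1 / n%:R <= `|x i| ].

(* The pair (x_k, A_{k+1}) reached after the history [:: r_k; ...; r_1]. *)
Fixpoint state (sol : solver) (h : seq (signs n)) :
    ('I_n -> R) * {set 'I_n} :=
  match h with
  | [::] => (fun=> 0, [set: 'I_n])
  | r :: h' =>
      let: (x, A) := state sol h' in
      let x' := next_coloring A x (sol h') r in
      (x', next_alive A x')
  end.

Definition coloring (sol : solver) (h : seq (signs n)) : 'I_n -> R :=
  (state sol h).1.

Definition alive (sol : solver) (h : seq (signs n)) : {set 'I_n} :=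
  (state sol h).2.

Definition optimal_solver (Sys : {set {set 'I_n}}) (t : nat) (sol : solver) :
    Prop :=
  forall h : seq (signs n), (size h < num_steps R n)%N ->
    sdp_optimal Sys t (alive sol h) (coloring sol h) (sol h).

(* An outcome lists the draws in chronological order r_1, ..., r_T. *)
Definition outcome := (num_steps R n).-tuple (signs n).

Definition final_disc (sol : solver) (S : {set 'I_n}) (w : outcome) : R :=
  \sum_(i in S) coloring sol (rev w) i.

End Algorithm.

(* The uniform law on a finite type.  On outcome R n it makes r_1, ..., r_T
   independent, with independent uniform coordinates in {-1, 1}. *)
Definition unif_pr (R : realType) (Omega : finType) (E : {set Omega}) : R :=
  #|E|%:R / #|Omega|%:R.

(* Main.v *)
Require Import Defs.
From HB Require Import structures.
From mathcomp Require Import all_boot all_order all_algebra.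
From mathcomp Require Import reals topology normedtype sequences derive exp.
From mathcomp Require Import ring lra.

Set Implicit Arguments.
Unset Strict Implicit.
Unset Printing Implicit Defensive.
Import Order.TTheory GRing.Theory Num.Theory.
Import numFieldNormedType.Exports.

Local Open Scope ring_scope.

(** While S is big its discrepancy stays 0.  Once S is small, fewer than a * t
    of its elements are alive, and every step of the walk changes
    D = \sum_(i in S) x i with a variance of at most twice the expected growth
    of the sum of the x i ^ 2 over the alive i in S, whose own fluctuation is
    bounded in the same way.  Hence, for 0 <= theta <= 1/20,
      exp (theta D + 4 theta^2 \sum_(i in S alive) (4 - x i ^ 2))
    is a supermartingale, where 2 bounds all the |x i|, and so
    E [exp (theta D)] <= exp (16 theta^2 a t).  Markov's inequality with
    theta = lambda / (80 a sqrt t) then gives exp (- lambda^2 / (100 a)).  The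
    condition on theta costs nothing: |D| <= 4 a t always, so only
    lambda <= 4 a sqrt t matters. *)

Section ExponentialInequalities.
Variable R : realType.
Implicit Types x y z c : R.

Lemma is_derive_ge0_le (f f' : R -> R) :
  (forall x, is_derive x 1 f (f' x)) -> (forall x, 0 <= x -> 0 <= f' x) ->
  forall x, 0 <= x -> f 0 <= f x.
Proof.
move=> f_drv f'_ge0 x x_ge0; apply: (@ger0_derive1_ndecry _ f 0) => //.
- by move=> y; rewrite in_itv/= andbT derive1E derive_val => /ltW/f'_ge0.
- apply: continuous_subspaceT => y.
  exact/differentiable_continuous/derivable1_diffP.
Qed.

Lemma sinh_le_mul_cosh x : 0 <= x ->
  expR x - expR (- x) <= x * (expR x + expR (- x)).
Proof.
move=> x_ge0; rewrite -subr_ge0.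
pose f y := y * (expR y + expR (- y)) - (expR y - expR (- y)) : R.
have f0 : f 0 = 0 by rewrite /f oppr0 subrr mul0r subrr.
rewrite -f0.
apply: (@is_derive_ge0_le f (fun y => y * (expR y - expR (- y)))) => // y.
- by apply: is_derive_eq; rewrite /GRing.scale /=; ring.
- by move=> y_ge0; rewrite mulr_ge0// subr_ge0 ler_expR; lra.
Qed.

Lemma cosh_le_expR_sqr x : (expR x + expR (- x)) / 2 <= expR (x ^+ 2 / 2).
Proof.
wlog x_ge0 : x / 0 <= x.
  move=> cosh_le; have [/cosh_le//|/ltW x_le0] := lerP 0 x.
  by have := cosh_le (- x); rewrite opprK sqrrN addrC; apply; lra.
pose f y := - ((expR y + expR (- y)) * expR (- (y ^+ 2 / 2))) : R.
pose f' y := (y * (expR y + expR (- y)) - (expR y - expR (- y))) *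
   expR (- (y ^+ 2 / 2)).
have : f 0 <= f x.
  apply: (@is_derive_ge0_le f f') => // y.
  - by apply: is_derive_eq; rewrite /GRing.scale /= /f'; field.
  - by move=> y_ge0; rewrite mulr_ge0 ?expR_ge0// subr_ge0 sinh_le_mul_cosh.
rewrite /f expr0n/= mul0r !oppr0 expR0 mulr1 lerN2.
by rewrite [expR (- (_ / _))]expRN !ler_pdivrMr ?expR_gt0//; lra.
Qed.

Lemma expRN_le_affine z c : 0 <= z <= c -> expR (- z) <= 1 - z / (1 + c).
Proof.
move=> /andP[z_ge0 z_le].
have inv1z : (1 + z)^-1 = 1 - z / (1 + z) by field; rewrite gt_eqF//; lra.
apply: (@le_trans _ _ (1 + z)^-1).
  by rewrite expRN lef_pV2 ?posrE ?expR_gt0 ?expR_ge1Dx//; lra.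
by rewrite inv1z lerB// ler_wpM2l// lef_pV2 ?posrE; lra.
Qed.

Lemma expRD_le_mean x y : expR (x + y) <= (expR (2 * x) + expR (2 * y)) / 2.
Proof.
rewrite expRD !expRM_natl ler_pdivlMr//.
by have := sqr_ge0 (expR x - expR y); rewrite sqrrB; lra.
Qed.

Lemma ln_ge1BV x : 0 < x -> 1 - x^-1 <= ln x.
Proof.
move=> x_gt0; have := @le_ln1Dx R (x^-1 - 1).
by rewrite subrKC lnV ?posrE//; have := invr_gt0 x; rewrite x_gt0; lra.
Qed.

End ExponentialInequalities.

Section UniformMean.
Variables (R : realType) (Omega : finType).
Implicit Types (F G D X Z : Omega -> R) (E : {set Omega}).

Definition mean F : R := (\sum_w F w) / #|Omega|%:R.

Lemma eq_mean F G : F =1 G -> mean F = mean G.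
Proof. by move=> FG; rewrite /mean (eq_bigr _ (fun w _ => FG w)). Qed.

Lemma ler_mean F G : (forall w, F w <= G w) -> mean F <= mean G.
Proof. by move=> FG; rewrite ler_wpM2r ?invr_ge0// ler_sum. Qed.

Lemma meanD F G : mean (fun w => F w + G w) = mean F + mean G.
Proof. by rewrite /mean big_split mulrDl. Qed.

Lemma meanZ c F : mean (fun w => c * F w) = c * mean F.
Proof. by rewrite /mean -big_distrr mulrA. Qed.

Lemma mean_sum (I : Type) (s : seq I) (P : pred I) (F : I -> Omega -> R) :
  mean (fun w => \sum_(i <- s | P i) F i w) = \sum_(i <- s | P i) mean (F i).
Proof. by rewrite /mean exchange_big big_distrl. Qed.

Lemma mean_cst c : (0 < #|Omega|)%N -> mean (fun=> c) = c.
Proof.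
move=> Omega_gt0; rewrite /mean sumr_const -[c *+ _]mulr_natr mulfK//.
by rewrite pnatr_eq0 -lt0n.
Qed.

Lemma unif_pr_le_mean E F :
  (forall w, 0 <= F w) -> {in E, forall w, 1 <= F w} -> unif_pr R E <= mean F.
Proof.
move=> F_ge0 F_ge1; rewrite ler_wpM2r ?invr_ge0//.
rewrite -sum1_card natr_sum big_mkcond /=; apply: ler_sum => w _.
by case: ifP => // /F_ge1.
Qed.

Lemma unif_pr_norm_ge_le D theta c : 0 <= theta ->
  unif_pr R [set w | c <= `|D w|]
    <= expR (- (theta * c)) * (mean (fun w => expR (theta * D w)) +
                               mean (fun w => expR (- theta * D w))).
Proof.
move=> theta_ge0; rewrite -meanD -meanZ.
apply: unif_pr_le_mean => w; first by rewrite mulr_ge0 ?addr_ge0 ?expR_ge0.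
rewrite inE mulrDr -!expRD -expR0 => /(ler_wpM2l theta_ge0).
case: ger0P => _ D_ge.
  by rewrite ler_wpDr ?expR_ge0// ler_expR; lra.
by rewrite ler_wpDl ?expR_ge0// ler_expR; lra.
Qed.

Hypothesis Omega_gt0 : (0 < #|Omega|)%N.

Lemma mean_expRN_le Z c : (forall w, 0 <= Z w <= c) ->
  mean (fun w => expR (- Z w)) <= expR (- (mean Z / (1 + c))).
Proof.
move=> Z_itv; apply: le_trans (expR_ge1Dx _).
have -> : 1 - mean Z / (1 + c) = mean (fun w => 1 + - (1 + c)^-1 * Z w).
  by rewrite meanD meanZ mean_cst// mulNr mulrC.
by apply: ler_mean => w; rewrite mulNr mulrC expRN_le_affine.
Qed.

(* X and Z may be correlated: AM-GM separates them. *)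
Lemma mean_expRB_le1 X Z K c :
  mean (fun w => expR (2 * X w)) <= expR (2 * K) ->
  (forall w, 0 <= Z w <= c) -> (1 + 2 * c) * K <= mean Z ->
  mean (fun w => expR (X w - Z w)) <= 1.
Proof.
move=> X_le Z_itv K_le.
have c_ge0 : 0 <= c.
  have /card_gt0P[w _] := Omega_gt0.
  by have /andP[] := Z_itv w; exact: le_trans.
have Z_le : mean (fun w => expR (- (2 * Z w))) <= expR (- (2 * K)).
  apply: le_trans (@mean_expRN_le _ (2 * c) _) _ => [w|].
    by have := Z_itv w; lra.
  by rewrite meanZ ler_expR lerN2 ler_pdivlMr; lra.
apply: (@le_trans _ _ (mean (fun w =>
    expR (- (2 * K)) / 2 * expR (2 * X w)
    + expR (2 * K) / 2 * expR (- (2 * Z w))))).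
  apply: ler_mean => w; have := expRD_le_mean (X w - K) (K - Z w).
  by rewrite addrA subrK !mulrBr !expRD; lra.
have := ler_wpM2l (expR_ge0 (- (2 * K))) X_le.
have := ler_wpM2l (expR_ge0 (2 * K)) Z_le.
by rewrite meanD !meanZ -!expRD subrr addNr expR0; lra.
Qed.

End UniformMean.

Section TupleMean.
Variables (R : realType) (X : finType).
Implicit Types F : seq X -> R.

Lemma mean_rev_tuple F (m : nat) :
  mean (fun w : m.-tuple X => F (rev w)) = mean (fun w : m.-tuple X => F w).
Proof.
have revK : involutive (fun w : m.-tuple X => rev_tuple w).
  by move=> w; apply: val_inj; rewrite /= revK.
by rewrite /mean [in RHS](reindex_inj (inv_inj revK)).
Qed.

Lemma mean_tuple_cons F (m : nat) :
  mean (fun w : m.+1.-tuple X => F w)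
    = mean (fun w : m.-tuple X => mean (fun a => F (a :: w))).
Proof.
rewrite /mean -big_distrl !card_tuple expnS natrM invfM mulrA /=.
congr (_ / _ / _); rewrite pair_big.
rewrite (reindex (fun p : m.-tuple X * X => [tuple of p.2 :: p.1]))//=.
exists (fun w : m.+1.-tuple X => ([tuple of behead w], thead w)).
  by move=> [w a] _; congr pair; apply: val_inj.
by move=> w _; rewrite [RHS]tuple_eta; apply: val_inj.
Qed.

Lemma supermartingale_mean F (T : nat) :
  (forall h, (size h < T)%N -> mean (fun a => F (a :: h)) <= F h) ->
  mean (fun w : T.-tuple X => F (rev w)) <= F [::].
Proof.
move=> F_super; rewrite mean_rev_tuple.
elim: T F_super => [|T IHT] F_super.
  rewrite /mean card_tuple expn0 divr1 (big_pred1 [tuple])// => w.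
  exact/esym/eqP/tuple0.
rewrite mean_tuple_cons.
apply: le_trans (IHT (fun h size_h => F_super h (ltnW size_h))).
by apply: ler_mean => w; rewrite F_super ?size_tuple.
Qed.

End TupleMean.

Section EuclideanRowVectors.
Variables (R : realType) (n : nat).
Implicit Types u v : 'rV[R]_n.

Lemma dotC u v : dot u v = dot v u.
Proof. by apply: eq_bigr => j _; rewrite mulrC. Qed.

Fact dot_is_scalar u : scalar (dot u).
Proof.
move=> c v w; rewrite /dot big_distrr -big_split; apply: eq_bigr => j _ /=.
by rewrite !mxE mulrDr mulrCA.
Qed.

HB.instance Definition _ u :=
  GRing.isLinear.Build R 'rV[R]_n R *%R (dot u) (dot_is_scalar u).

Lemma dotZl c u v : dot (c *: u) v = c * dot u v.
Proof. by rewrite dotC linearZ /= dotC. Qed.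

Lemma sqnorm2_ge0 u : 0 <= sqnorm2 u.
Proof. by apply: sumr_ge0 => j _; rewrite -expr2 sqr_ge0. Qed.

Lemma sqnorm2_eq0 u : sqnorm2 u = 0 -> u = 0.
Proof.
move=> u0; apply/rowP => j; rewrite mxE; apply/eqP; rewrite -sqrf_eq0 expr2.
move/eqP: u0; rewrite psumr_eq0 => [/allP/(_ j)|i _].
  by rewrite mem_index_enum => /(_ isT).
by rewrite -expr2 sqr_ge0.
Qed.

Lemma sqnorm2Z c u : sqnorm2 (c *: u) = c ^+ 2 * sqnorm2 u.
Proof. by rewrite /sqnorm2 linearZ /= dotZl mulrA -expr2. Qed.

Lemma sqnorm2D u v : sqnorm2 (u + v) = sqnorm2 u + 2 * dot u v + sqnorm2 v.
Proof.
by rewrite /sqnorm2 linearD /= !(dotC (u + v)) !linearD /= (dotC v u); ring.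
Qed.

Lemma sqr_dot_le u v : dot u v ^+ 2 <= sqnorm2 u * sqnorm2 v.
Proof.
have [/sqnorm2_eq0->|v_neq0] := eqVneq (sqnorm2 v) 0.
  by rewrite linear0 expr0n mulr_ge0 ?sqnorm2_ge0.
have v_gt0 : 0 < sqnorm2 v by rewrite lt_def v_neq0 sqnorm2_ge0.
rewrite -subr_ge0 -(pmulr_rge0 _ v_gt0).
apply: le_trans (sqnorm2_ge0 (sqnorm2 v *: u + - dot u v *: v)) _.
by rewrite sqnorm2D !sqnorm2Z linearZ /= dotZl; lra.
Qed.

Lemma sqnorm2D_le (a b s : R) u v : 0 <= a -> 0 <= b -> 0 <= s ->
  sqnorm2 u <= a ^+ 2 * s -> sqnorm2 v <= b ^+ 2 * s ->
  sqnorm2 (u + v) <= (a + b) ^+ 2 * s.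
Proof.
move=> a_ge0 b_ge0 s_ge0 u_le v_le; rewrite sqnorm2D.
have uv_le : dot u v <= a * b * s.
  apply: le_trans (ler_norm _) _.
  rewrite -ler_sqr ?nnegrE ?mulr_ge0// real_normK ?num_real//.
  apply: le_trans (sqr_dot_le u v) _.
  have -> : (a * b * s) ^+ 2 = (a ^+ 2 * s) * (b ^+ 2 * s) by ring.
  by rewrite ler_pM ?sqnorm2_ge0.
by lra.
Qed.

End EuclideanRowVectors.

Section RandomSigns.
Variables (R : realType) (n : nat).
Implicit Types (u : 'rV[R]_n) (r : signs n) (j k : 'I_n).

Lemma card_signs : #|{: signs n}| = (2 ^ n)%N.
Proof. by rewrite card_ffun card_bool card_ord. Qed.

Lemma card_signs_gt0 : (0 < #|{: signs n}|)%N.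
Proof. by rewrite card_signs expn_gt0. Qed.

Lemma dot_signE r u : dot (sign_vec R r) u = \sum_j (-1) ^+ r j * u 0 j.
Proof. by apply: eq_bigr => j _; rewrite mxE. Qed.

Lemma sqnorm2_sign r : sqnorm2 (sign_vec R r) = n%:R.
Proof.
rewrite /sqnorm2 dot_signE -[in RHS](card_ord n) -sumr_const.
by apply: eq_bigr => j _; rewrite mxE -expr2 sqrr_sign.
Qed.

Lemma mean_expR_dot_sign u :
  mean (fun r : signs n => expR (dot (sign_vec R r) u)) <= expR (sqnorm2 u / 2).
Proof.
rewrite /mean ler_pdivrMr ?ltr0n ?card_signs_gt0//.
under eq_bigr => r _ do rewrite dot_signE expR_sum.
rewrite -(bigA_distr_bigA (fun j b => expR ((-1) ^+ (b : bool) * u 0 j))).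
rewrite card_signs natrX /sqnorm2 /dot big_distrl expR_sum /=.
rewrite -[n in 2 ^+ n]card_ord -prodr_const -big_split /=.
apply: ler_prod => j _; rewrite sumr_ge0 => [|b _]; last exact: expR_ge0.
rewrite big_bool /= expr1 expr0 mulN1r mul1r addrC -expr2.
by have := cosh_le_expR_sqr (u 0 j); lra.
Qed.

Lemma mean_sign_mul j k :
  mean (fun r : signs n => (-1) ^+ r j * (-1) ^+ r k) = (j == k)%:R :> R.
Proof.
have [<-|jk] := eqVneq j k.
  under eq_mean do rewrite -expr2 sqrr_sign.
  by rewrite mean_cst ?card_signs_gt0.
pose flip r : signs n := [ffun i => (i == j) (+) r i].
have flipK : involutive flip.
  by move=> r; apply/ffunP => i; rewrite !ffunE addbA addbb.
set m := LHS; suff : m = - m by move=> /=; lra.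
rewrite {1}/m /mean (reindex_inj (inv_inj flipK)) /= -mulNr -sumrN.
congr (_ / _); apply: eq_bigr => r _.
by rewrite !ffunE eqxx eq_sym (negbTE jk) /= signrN mulNr.
Qed.

Lemma mean_sqr_dot_sign u :
  mean (fun r : signs n => dot (sign_vec R r) u ^+ 2) = sqnorm2 u.
Proof.
under eq_mean do rewrite dot_signE expr2 big_distrlr /=.
rewrite mean_sum; apply: eq_bigr => j _; rewrite mean_sum (bigD1 j)//=.
have covE k :
    mean (fun r : signs n => (-1) ^+ r j * u 0 j * ((-1) ^+ r k * u 0 k))
    = u 0 j * u 0 k * (j == k)%:R.
  by rewrite -mean_sign_mul -meanZ; apply: eq_mean => r; ring.
rewrite covE eqxx mulr1 big1 ?addr0// => k; rewrite covE eq_sym => /negbTE->.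
by rewrite mulr0.
Qed.

End RandomSigns.

(* The factor 2 (1 + 2 kappa |theta|)^2 is the bound on step_direction below
   and 1 + 2 kappa theta^2 is the loss in expRN_le_affine: the growth of the
   squares, taken kappa theta^2 times, must pay for the linear part of the
   step. *)
Definition admissible_rate (R : realType) (kappa theta : R) : bool :=
  (0 <= kappa) &&
  (2 * (1 + 2 * kappa * `|theta|) ^+ 2 * (1 + 2 * kappa * theta ^+ 2) <= kappa).

Lemma admissible_rateN (R : realType) (kappa theta : R) :
  admissible_rate kappa (- theta) = admissible_rate kappa theta.
Proof. by rewrite /admissible_rate normrN sqrrN. Qed.

Lemma admissible_rate4 (R : realType) (theta : R) :
  `|theta| <= 1 / 20 -> admissible_rate 4 theta.
Proof.
rewrite /admissible_rate ler0n -[theta ^+ 2]real_normK ?num_real//=.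
move: `|theta| (normr_ge0 theta) => s s_ge0 s_le.
have linear_le : (1 + 2 * 4 * s) ^+ 2 <= 49 / 25 by nra.
have square_le : s ^+ 2 <= 1 / 400 by nra.
by have := sqr_ge0 s; nra.
Qed.

Section RandomStep.
Variables (R : realType) (n : nat) (B : {set 'I_n}).
Variables (u : 'I_n -> 'rV[R]_n) (x : 'I_n -> R) (g : R).
Hypotheses (g_ge0 : 0 <= g) (gn_le1 : g * n%:R <= 1).
Hypothesis sqnorm2_u_le1 : forall i, i \in B -> sqnorm2 (u i) <= 1.
Implicit Types (r : signs n) (i : 'I_n).

Definition increment r i : R := g * dot (sign_vec R r) (u i).

Lemma sum_sqr_increment_le1 r : \sum_(i in B) increment r i ^+ 2 <= 1.
Proof.
apply: (@le_trans _ _ (\sum_(i in B) g ^+ 2 * n%:R)).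
  apply: ler_sum => i iB; rewrite exprMn ler_wpM2l ?sqr_ge0//.
  apply: le_trans (sqr_dot_le _ _) _.
  by rewrite sqnorm2_sign ler_piMr ?sqnorm2_u_le1.
rewrite sumr_const -[_ *+ _]mulr_natr.
apply: (@le_trans _ _ ((g * n%:R) ^+ 2)); last by rewrite expr_le1 ?mulr_ge0.
rewrite exprMn expr2 -!mulrA !ler_wpM2l// ler_nat.
by rewrite -[leqRHS]card_ord max_card.
Qed.

Lemma increment_le1 r i : i \in B -> `|increment r i| <= 1.
Proof.
move=> iB; rewrite -(@expr_le1 _ 2)// real_normK ?num_real//.
apply: le_trans (sum_sqr_increment_le1 r); rewrite (bigD1 i)//= lerDl.
by apply: sumr_ge0 => k _; rewrite sqr_ge0.
Qed.

Lemma mean_sum_sqr_increment :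
  mean (fun r => \sum_(i in B) increment r i ^+ 2)
    = g ^+ 2 * \sum_(i in B) sqnorm2 (u i).
Proof.
rewrite mean_sum big_distrr; apply: eq_bigr => i _ /=.
by under eq_mean do rewrite exprMn; rewrite meanZ mean_sqr_dot_sign.
Qed.

Lemma sum_sqr_changeE r :
  \sum_(i in B) ((x i + increment r i) ^+ 2 - x i ^+ 2)
    = 2 * g * dot (sign_vec R r) (\sum_(i in B) x i *: u i)
      + \sum_(i in B) increment r i ^+ 2.
Proof.
rewrite linear_sum big_distrr -big_split; apply: eq_bigr => i _ /=.
by rewrite [dot _ (_ *: _)]linearZ /= /increment; ring.
Qed.

Hypothesis sum_u_le :
  sqnorm2 (\sum_(i in B) u i) <= 2 * \sum_(i in B) sqnorm2 (u i).
Hypothesis sum_xu_le :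
  sqnorm2 (\sum_(i in B) x i *: u i) <= 2 * \sum_(i in B) sqnorm2 (u i).
Variables theta kappa : R.
Hypothesis kappa_adm : admissible_rate kappa theta.

Definition step_direction : 'rV[R]_n :=
  (theta * g) *: (\sum_(i in B) u i)
  + (- (2 * kappa * theta ^+ 2 * g)) *: (\sum_(i in B) x i *: u i).

Lemma sqnorm2_step_direction_le :
  sqnorm2 step_direction
    <= 2 * (1 + 2 * kappa * `|theta|) ^+ 2
       * (theta ^+ 2 * g ^+ 2 * \sum_(i in B) sqnorm2 (u i)).
Proof.
set W := \sum_(i in B) sqnorm2 (u i).
have W_ge0 : 0 <= W by apply: sumr_ge0 => i _; exact: sqnorm2_ge0.
have /andP[kappa_ge0 _] := kappa_adm.
have theta2E : theta ^+ 2 = `|theta| ^+ 2 by rewrite real_normK ?num_real.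
have -> : 2 * (1 + 2 * kappa * `|theta|) ^+ 2 * (theta ^+ 2 * g ^+ 2 * W)
    = (`|theta| * g + 2 * kappa * theta ^+ 2 * g) ^+ 2 * (2 * W).
  by rewrite theta2E; ring.
apply: sqnorm2D_le; rewrite ?(sqr_ge0, mulr_ge0)//.
  by rewrite sqnorm2Z exprMn theta2E -exprMn ler_wpM2l ?sqr_ge0.
by rewrite sqnorm2Z sqrrN ler_wpM2l ?sqr_ge0.
Qed.

Lemma step_exponentE r :
  theta * (\sum_(i in B) increment r i)
  - kappa * theta ^+ 2 * \sum_(i in B) ((x i + increment r i) ^+ 2 - x i ^+ 2)
  = dot (sign_vec R r) step_direction
    - kappa * theta ^+ 2 * \sum_(i in B) increment r i ^+ 2.
Proof.
rewrite sum_sqr_changeE /increment -big_distrr /= -linear_sum.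
by rewrite linearD /= ![dot _ (_ *: _)]linearZ /=; ring.
Qed.

Lemma mean_expR_step_le1 :
  mean (fun r => expR (theta * (\sum_(i in B) increment r i)
    - kappa * theta ^+ 2
      * \sum_(i in B) ((x i + increment r i) ^+ 2 - x i ^+ 2))) <= 1.
Proof.
have /andP[kappa_ge0 kappa_large] := kappa_adm.
have rate_ge0 : 0 <= kappa * theta ^+ 2 by rewrite mulr_ge0 ?sqr_ge0.
under eq_mean do rewrite step_exponentE.
apply: (@mean_expRB_le1 _ _ (card_signs_gt0 n)
  (fun r => dot (sign_vec R r) step_direction)
  (fun r => kappa * theta ^+ 2 * \sum_(i in B) increment r i ^+ 2)
  (sqnorm2 step_direction) (kappa * theta ^+ 2)).
- have := mean_expR_dot_sign (2 *: step_direction).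
  under eq_mean do rewrite linearZ /=.
  by rewrite sqnorm2Z => /le_trans; apply; rewrite ler_expR; lra.
- move=> r; rewrite ler_piMr ?sum_sqr_increment_le1// andbT mulr_ge0//.
  by apply: sumr_ge0 => i _; rewrite sqr_ge0.
- rewrite meanZ mean_sum_sqr_increment.
  apply: le_trans (ler_wpM2l _ sqnorm2_step_direction_le) _.
    by rewrite addr_ge0// mulr_ge0.
  set W := \sum_(i in B) _; have W_ge0 : 0 <= theta ^+ 2 * g ^+ 2 * W.
    by rewrite ?(sqr_ge0, mulr_ge0)// sumr_ge0// => i _; exact: sqnorm2_ge0.
  by have := ler_wpM2r W_ge0 kappa_large; lra.
Qed.

End RandomStep.

Lemma gamma_ge0 (R : realType) (n : nat) : 0 <= gamma R n.
Proof.
rewrite /gamma divr_ge0// mulr_ge0// ?exprn_ge0//.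
by case: n => [|n]; [rewrite ln0 | rewrite ln_ge0// ler1n].
Qed.

(* For n = 1, gamma is the junk value 1 / 0 = 0. *)
Lemma gamma_mul_le1 (R : realType) (n : nat) : gamma R n * n%:R <= 1.
Proof.
case: n => [|[|m]]; first by rewrite mulr0.
  by rewrite /gamma ln1 mulr0 invr0 mulr0 mul0r.
set n := m.+2; have n_ge2 : 2 <= n%:R :> R by rewrite ler_nat.
have n_gt0 : 0 < n%:R :> R by lra.
have nln_ge1 : 1 <= n%:R * ln n%:R :> R.
  have := ler_wpM2l (ltW n_gt0) (ln_ge1BV n_gt0).
  by rewrite mulrBr mulfV ?gt_eqF//; lra.
have ln_gt0 : 0 < ln n%:R :> R by rewrite -(pmulr_rgt0 _ n_gt0); lra.
have -> : gamma R n * n%:R = (n%:R * ln n%:R)^-1.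
  by rewrite /gamma; field; rewrite !gt_eqF.
by rewrite invf_le1//; lra.
Qed.

Section Walk.
Variables (R : realType) (n t : nat) (Sys : {set {set 'I_n}}).
Variables (sol : solver R n) (T : nat) (S : {set 'I_n}).
Hypothesis sol_feasible : forall h, (size h < T)%N ->
  sdp_feasible Sys t (alive sol h) (coloring sol h) (sol h).
Hypothesis SinSys : S \in Sys.
Implicit Types (h l : seq (signs n)) (r : signs n) (i : 'I_n).

Local Notation x := (coloring sol).
Local Notation A := (alive sol).
Local Notation step h := (increment (sol h) (gamma R n)).

Lemma coloring_cons r h i :
  x (r :: h) i = if i \in A h then x h i + step h r i else x h i.
Proof. by rewrite /coloring /alive /=; case: (state sol h). Qed.

Lemma alive_cons r h :
  A (r :: h) = A h :\: [set i | 1 - 1 / n%:R <= `|x (r :: h) i| ].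
Proof. by rewrite /coloring /alive /=; case: (state sol h). Qed.

Lemma alive_cons_sub r h : A (r :: h) \subset A h.
Proof. by rewrite alive_cons subsetDl. Qed.

Lemma alive_cat_sub l h : A (l ++ h) \subset A h.
Proof.
by elim: l => //= r l; apply: subset_trans; exact: alive_cons_sub.
Qed.

Lemma coloring_cat_frozen l h i : i \notin A h -> x (l ++ h) i = x h i.
Proof.
move=> iNA; elim: l => //= r l IHl; rewrite coloring_cons IHl ifN//.
by apply: contra iNA; apply/subsetP/alive_cat_sub.
Qed.

Lemma alive_coloring_le1 h i : i \in A h -> `|x h i| <= 1.
Proof.
case: h => [|r h]; first by rewrite normr0.
rewrite alive_cons !inE -ltNge => /andP[/ltW/le_trans x_le _]; apply: x_le.
by rewrite gerBl divr_ge0.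
Qed.

Lemma coloring_le2 h i : (size h <= T)%N -> `|x h i| <= 2.
Proof.
elim: h => [|r h IHh] /= size_h; first by rewrite normr0.
rewrite coloring_cons; case: ifP => [iA|_]; last exact/IHh/ltnW.
apply: le_trans (ler_normD _ _) _; apply: lerD (alive_coloring_le1 iA) _.
apply: increment_le1 iA; [exact: gamma_ge0 | exact: gamma_mul_le1 |].
exact: sdp_unit (sol_feasible size_h).
Qed.

Lemma four_sub_sqr_coloring_ge0 h i : (size h <= T)%N -> 0 <= 4 - x h i ^+ 2.
Proof. by move=> /(coloring_le2 i); rewrite ler_norml => /andP[]; nra. Qed.

Definition big h : bool := (param_a * t <= #|S :&: A h|)%N.

Lemma big_cons r h : big (r :: h) -> big h.
Proof.
by move=> /leq_trans; apply; rewrite subset_leq_card// setIS ?alive_cons_sub.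
Qed.

Lemma card_small h : ~~ big h -> #|S :&: A h|%:R <= (param_a * t)%:R :> R.
Proof. by rewrite -ltnNge ler_nat => /ltnW. Qed.

Definition disc h : R := \sum_(i in S) x h i.

Lemma disc_nil : disc [::] = 0.
Proof. by rewrite /disc big1. Qed.

Lemma disc_cons r h :
  disc (r :: h) = disc h + \sum_(i in S :&: A h) step h r i.
Proof.
under [X in _ + X]eq_bigl do rewrite inE.
rewrite /disc big_mkcondr -big_split; apply: eq_bigr => i _ /=.
by rewrite coloring_cons; case: ifP; rewrite ?addr0.
Qed.

Lemma disc_cons_big r h : (size h < T)%N -> big h -> disc (r :: h) = disc h.
Proof.
move=> size_h big_h; rewrite disc_cons -big_distrr -linear_sum /=.
have /sqnorm2_eq0-> : sqnorm2 (\sum_(i in S :&: A h) sol h i) = 0.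
  by apply: (sdp_big (sol_feasible size_h)); rewrite inE SinSys.
by rewrite linear0 mulr0 addr0.
Qed.

Lemma disc_big h : (size h <= T)%N -> big h -> disc h = 0.
Proof.
elim: h => [|r h IHh] size_h big_rh; first exact: disc_nil.
have big_h := big_cons big_rh.
by rewrite disc_cons_big ?IHh ?(ltnW size_h).
Qed.

Lemma disc_cat_sub_le l h : (size (l ++ h) <= T)%N ->
  `|disc (l ++ h) - disc h| <= 4 * #|S :&: A h|%:R.
Proof.
move=> size_lh; rewrite /disc -sumrB (big_setID (A h)) /=.
rewrite [X in _ + X]big1 ?addr0 => [|i]; last first.
  by rewrite inE => /andP[iNA _]; rewrite coloring_cat_frozen// subrr.
apply: le_trans (ler_norm_sum _ _ _) _.
rewrite mulr_natr -sumr_const; apply: ler_sum => i _.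
apply: le_trans (ler_normB _ _) _.
have size_h : (size h <= T)%N.
  by rewrite (leq_trans _ size_lh)// size_cat leq_addl.
by have := coloring_le2 i size_lh; have := coloring_le2 i size_h; lra.
Qed.

Lemma small_history_split h : (size h <= T)%N -> ~~ big h ->
  exists l h0, [/\ h = l ++ h0, ~~ big h0 & disc h0 = 0].
Proof.
elim: h => [|r h IHh] size_h small_rh.
  by exists [::], [::]; split; rewrite ?disc_nil.
have [big_h|/(IHh (ltnW size_h))[l [h0 [-> small_h0 disc_h0]]]] :=
  boolP (big h).
  by exists [::], (r :: h); rewrite disc_cons_big ?disc_big ?(ltnW size_h).
by exists (r :: l), h0.
Qed.

(* Only the at most a * t elements still alive when S becomes small matter,
   and each of them moves within [-2, 2]. *)
Lemma disc_le h : (size h <= T)%N -> `|disc h| <= 4 * (param_a * t)%:R.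
Proof.
move=> size_h; have [big_h|small_h] := boolP (big h).
  by rewrite disc_big// normr0 mulr_ge0.
have [l [h0 [hE small_h0 disc_h0]]] := small_history_split size_h small_h.
rewrite hE in size_h *; have := disc_cat_sub_le size_h.
by rewrite disc_h0 subr0; have := card_small small_h0; lra.
Qed.

(* How much the sum of the x i ^ 2 can still grow once S is small. *)
Definition slack h : R :=
  if big h then 4 * (param_a * t)%:R
  else \sum_(i in S :&: A h) (4 - x h i ^+ 2).

Lemma slack_ge0 h : (size h <= T)%N -> 0 <= slack h.
Proof.
move=> size_h; rewrite /slack; case: ifP => _; first by rewrite mulr_ge0.
by apply: sumr_ge0 => i _; exact: four_sub_sqr_coloring_ge0.
Qed.

Lemma slack_le h : slack h <= 4 * (param_a * t)%:R.
Proof.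
rewrite /slack; case: ifPn => // small_h.
apply: (@le_trans _ _ (4 * #|S :&: A h|%:R)); last first.
  by rewrite ler_pM2l ?card_small.
rewrite mulr_natr -sumr_const; apply: ler_sum => i _.
by rewrite gerBl sqr_ge0.
Qed.

Lemma slack_cons_small r h : (size h < T)%N -> ~~ big h ->
  slack (r :: h) <=
    slack h - \sum_(i in S :&: A h) ((x h i + step h r i) ^+ 2 - x h i ^+ 2).
Proof.
move=> size_h small_h; rewrite /slack (negbTE small_h).
rewrite (negbTE (contra (@big_cons r h) small_h)) -sumrB.
have alive_sub : S :&: A (r :: h) \subset S :&: A h.
  by rewrite setIS// alive_cons_sub.
rewrite [leRHS](eq_bigr (fun i => 4 - x (r :: h) i ^+ 2)) => [|i]; last first.
  by rewrite inE coloring_cons => /andP[_ ->]; ring.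
rewrite [leRHS](big_setID (S :&: A (r :: h))) /= (setIidPr alive_sub) lerDl.
by apply: sumr_ge0 => i _; exact: four_sub_sqr_coloring_ge0.
Qed.

Section Potential.
Variables theta kappa : R.
Hypothesis kappa_adm : admissible_rate kappa theta.

Definition potential h : R :=
  expR (theta * disc h + kappa * theta ^+ 2 * slack h).

Let rate_ge0 : 0 <= kappa * theta ^+ 2.
Proof. by have /andP[kappa_ge0 _] := kappa_adm; rewrite mulr_ge0 ?sqr_ge0. Qed.

Lemma expR_disc_le_potential h : (size h <= T)%N ->
  expR (theta * disc h) <= potential h.
Proof. by move=> size_h; rewrite ler_expR lerDl mulr_ge0 ?slack_ge0. Qed.

Lemma potential_nil_le :
  potential [::] <= expR (kappa * theta ^+ 2 * (4 * (param_a * t)%:R)).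
Proof.
by rewrite /potential disc_nil mulr0 add0r ler_expR ler_wpM2l ?slack_le.
Qed.

Lemma mean_potential_cons_le h : (size h < T)%N ->
  mean (fun r => potential (r :: h)) <= potential h.
Proof.
move=> size_h; have [big_h|small_h] := boolP (big h).
  rewrite -[leRHS](mean_cst _ (card_signs_gt0 n)); apply: ler_mean => r.
  rewrite ler_expR disc_cons_big// lerD2l ler_wpM2l//.
  by rewrite [leRHS]/slack big_h slack_le.
have S_small : S \in small_sets Sys t (A h).
  by rewrite !inE SinSys andbT /= -/(big h).
have [_ /(_ S S_small) sum_le /(_ S S_small) weighted_le unit] :=
  sol_feasible size_h.
have unit_alive i : i \in S :&: A h -> sqnorm2 (sol h i) <= 1.
  by rewrite inE => /andP[_ /unit].
have := mean_expR_step_le1 (gamma_ge0 R n) (gamma_mul_le1 R n) unit_alive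
  sum_le weighted_le kappa_adm.
move=> /(ler_wpM2l (expR_ge0 (theta * disc h + kappa * theta ^+ 2 * slack h))).
rewrite mulr1 -meanZ; apply: le_trans; apply: ler_mean => r.
rewrite -expRD ler_expR disc_cons.
by have := ler_wpM2l rate_ge0 (slack_cons_small r size_h small_h); lra.
Qed.

Lemma mean_expR_disc_le :
  mean (fun w : T.-tuple (signs n) => expR (theta * disc (rev w)))
    <= expR (kappa * theta ^+ 2 * (4 * (param_a * t)%:R)).
Proof.
apply: le_trans potential_nil_le.
apply: le_trans (supermartingale_mean mean_potential_cons_le).
by apply: ler_mean => w; rewrite expR_disc_le_potential// size_rev size_tuple.
Qed.

End Potential.

Lemma unif_pr_disc_ge_le (theta d : R) : 0 <= theta <= 1 / 20 ->
  unif_pr R [set w : T.-tuple (signs n) | d <= `|disc (rev w)| ]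
    <= 2 * expR (16 * theta ^+ 2 * (param_a * t)%:R - theta * d).
Proof.
move=> /andP[theta_ge0 theta_le].
have adm : admissible_rate 4 theta by rewrite admissible_rate4 ?ger0_norm.
have admN : admissible_rate 4 (- theta) by rewrite admissible_rateN.
apply: le_trans (unif_pr_norm_ge_le _ _ theta_ge0) _.
have mean_le := mean_expR_disc_le adm; have := mean_expR_disc_le admN.
rewrite sqrrN => meanN_le.
rewrite [_ - theta * d]addrC expRD mulrCA ler_wpM2l ?expR_ge0//.
have -> : 16 * theta ^+ 2 * (param_a * t)%:R
    = 4 * theta ^+ 2 * (4 * (param_a * t)%:R) by ring.
by apply: le_trans (lerD mean_le meanN_le) _; lra.
Qed.

Lemma unif_pr_disc_ge_eq0 (d : R) : 4 * (param_a * t)%:R < d ->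
  unif_pr R [set w : T.-tuple (signs n) | d <= `|disc (rev w)| ] = 0.
Proof.
move=> d_gt; rewrite /unif_pr (_ : [set _ | _] = set0) ?cards0 ?mul0r//.
apply/setP => w; rewrite !inE; apply/negbTE; rewrite -ltNge.
by rewrite (le_lt_trans _ d_gt)// disc_le// size_rev size_tuple.
Qed.

End Walk.

Theorem theorem6 (R : realType) (n t : nat) (Sys : {set {set 'I_n}})
    (t_gt0 : (0 < t)%N) (degSys : max_degree Sys t)
    (sol : solver R n) (sol_opt : optimal_solver Sys t sol)
    (S : {set 'I_n}) (SinSys : S \in Sys)
    (lambda : R) (lambda_ge0 : 0 <= lambda) :
  unif_pr R [set w : outcome R n |
      lambda * Num.sqrt t%:R <= `|final_disc sol S w| ]
    <= 8 * expR (- (lambda ^+ 2 / (100 * param_a)%:R)).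
Proof.
have sol_feasible h : (size h < num_steps R n)%N ->
    sdp_feasible Sys t (alive sol h) (coloring sol h) (sol h).
  by move=> /sol_opt[].
set s : R := Num.sqrt t%:R; set a : R := param_a%:R.
have s_gt0 : 0 < s by rewrite sqrtr_gt0 ltr0n.
have at_eq : (param_a * t)%:R = a * s ^+ 2 :> R by rewrite sqr_sqrtr ?natrM.
have [lambda_le|lambda_gt] := lerP lambda (4 * a * s); last first.
  rewrite (unif_pr_disc_ge_eq0 sol_feasible SinSys).
    by rewrite mulr_ge0 ?expR_ge0.
  by rewrite at_eq expr2 !mulrA ltr_pM2r.
have as_gt0 : 0 < 80 * a * s by rewrite !mulr_gt0// ltr0n.
have theta_itv : 0 <= lambda / (80 * a * s) <= 1 / 20.
  by rewrite divr_ge0 ?(ltW as_gt0)//= ler_pdivrMr//; lra.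
apply: le_trans (unif_pr_disc_ge_le sol_feasible SinSys _ theta_itv) _.
rewrite at_eq [X in 2 * expR X](_ : _ = - (lambda ^+ 2 / (100 * param_a)%:R)).
  by rewrite ler_wpM2r ?expR_ge0 ?ler_nat.
by rewrite natrM -/a; field; rewrite !gt_eqF// ltr0n.
Qed.
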